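(* Let $-1<q<1$ and let $\omega_q$ be the Fock vacuum state on the $q$-deformed $C^*$-algebra $\mathfrak{R}_q$ acting on the $q$-deformed Fock space $\Gamma_q(\ell^2(\mathbb{Z}))$. Then the tail algebra $\xi_{\omega_q}^\perp$ of the stochastic process $(\mathfrak{A},\Gamma_q(\ell^2(\mathbb{Z})),\{\iota_j\}_{j\in\mathbb{Z}},\zeta_q)$ is trivial, i.e. $\xi_{\omega_q}^\perp=\mathbb{C}I$.
   Context: $q$-deformed Fock space. For $-1<q<1$ and a Hilbert space $\mathcal{H}$, $\Gamma_q(\mathcal{H})$ is the completion of the algebraic linear span of a unit vacuum vector $\zeta_q$ and the vectors $f_1\otimes\cdots\otimes f_n$ ($f_j\in\mathcal{H}$, $n\ge1$) with respect to $$\langle f_1\otimes\cdots\otimes f_m,g_1\otimes\cdots\otimes g_n\rangle_q:=\delta_{n,m}\sum_{\pi\in\mathbb{P}_n}q^{i(\pi)}\langle f_1,g_{\pi(1)}\rangle\cdots\langle f_n,g_{\pi(n)}\rangle,$$ where $\mathbb{P}_n$ is the symmetric group and $i(\pi)$ is the number of inversions of $\pi$. The creator is $l^\dagger(f)\zeta_q=f$, $l^\dagger(f)f_1\otimes\cdots\otimes f_n=f\otimes f_1\otimes\cdots\otimes f_n$, and the annihilator is $l(f)\zeta_q=0$, $l(f)(f_1\otimes\cdots\otimes f_n)=\sum_{k=1}^nq^{k-1}\langle f_k,f\rangle f_1\otimes\cdots\otimes f_{k-1}\otimes f_{k+1}\otimes\cdots\otimes f_n$. They extend to bounded, mutually adjoint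 operators satisfying $l(f)l^\dagger(g)-ql^\dagger(g)l(f)=\langle g,f\rangle I$. For $\mathcal{H}=\ell^2(\mathbb{Z})$ with canonical orthonormal basis $\{e_j\}_{j\in\mathbb{Z}}$, put $l_j:=l(e_j)$. $\mathfrak{R}_q$ is the unital $C^*$-algebra generated by $\{l_j:j\in\mathbb{Z}\}$ and $\omega_q=\langle\cdot\,\zeta_q,\zeta_q\rangle_q$. Process. $\mathfrak{A}$ is the universal unital $C^*$-algebra generated by an element $a$ with $aa^*-qa^*a=1$, and $\iota_j:\mathfrak{A}\to\mathcal{B}(\Gamma_q(\ell^2(\mathbb{Z})))$ is the unique unital $*$-homomorphism with $\iota_j(a)=l_j$. Tail algebra. With $\bigvee$ denoting the von Neumann algebra generated, $$\xi_{\omega_q}^\perp:=\bigcap_{I\subset\mathbb{Z},\ I\text{ finite}}\Big(\bigcup_{K\cap I=\emptyset,\ K\text{ finite}}\Big(\bigvee_{k\in K}\iota_k(\mathfrak{A})\Big)\Big)''.$$ *)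

(* Defs.v *)
From HB Require Import structures.
From mathcomp Require Import all_boot all_order all_algebra all_fingroup.
From mathcomp Require Import complex ring lra.
From mathcomp Require Import all_classical all_reals all_analysis.

(* Inner products are linear in the first argument. *)

Set Implicit Arguments.
Unset Strict Implicit.
Unset Printing Implicit Defensive.

Import Order.TTheory GRing.Theory Num.Theory.
Import numFieldNormedType.Exports.

Local Open Scope classical_set_scope.
Local Open Scope ring_scope.

Notation "x +i* y" := (complex.Complex x y) : ring_scope.
Notation "x %:C" := (complex.real_complex _ x) : ring_scope.

HB.mixin Record NormedModule_hasDot (R : realType) H
    & CompleteNormedModule R[i] H := {
  dotp : {dot H for Num.conj} ;
  dotp_norm : forall u : H, `|u| ^+ 2 = dotp u u
}.

#[short(type="hilbertType")]
HB.structure Definition Hilbert (R : realType) :=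
  {H of CompleteNormedModule R[i] H & NormedModule_hasDot R H}.

(* The norm is a field of the mixin because Hierarchy Builder has no join of
   normedModType and algType below numDomainType. *)
HB.mixin Record Algebra_isCStar (R : realType) A & GRing.Algebra R[i] A := {
  cnorm : A -> R ;
  star : A -> A ;
  cnormD : forall x y, cnorm (x + y) <= cnorm x + cnorm y ;
  cnormZ : forall (c : R[i]) x, (cnorm (c *: x))%:C = `|c| * (cnorm x)%:C ;
  cnorm0_eq0 : forall x, cnorm x = 0 -> x = 0 ;
  cnormM : forall x y, cnorm (x * y) <= cnorm x * cnorm y ;
  cnorm_complete : forall u : nat -> A,
    (forall e : R, 0 < e -> exists N : nat, forall m n : nat,
      (N <= m)%N -> (N <= n)%N -> cnorm (u m - u n) < e) ->
    exists x : A, forall e : R, 0 < e -> exists N : nat, forall n : nat,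
      (N <= n)%N -> cnorm (u n - x) < e ;
  starK : involutive star ;
  starD : {morph star : x y / x + y} ;
  starZ : forall (c : R[i]) x, star (c *: x) = c^* *: star x ;
  starM : forall x y, star (x * y) = star y * star x ;
  cnorm_star : forall x, cnorm (star x * x) = cnorm x ^+ 2
}.

#[short(type="cstarAlgType")]
HB.structure Definition CStarAlgebra (R : realType) :=
  {A of GRing.Algebra R[i] A & Algebra_isCStar R A}.

Section UniversalAlgebra.
Context (R : realType) (q : R).

Definition q_relation (A : cstarAlgType R) (a : A) :=
  a * star a - q%:C *: (star a * a) = 1.

Definition cnorm_closed (A : cstarAlgType R) (S : {pred A}) :=
  forall x, (forall e : R, 0 < e -> exists2 y, y \in S & cnorm (x - y) < e) ->
    x \in S.

Definition cstar_generated (A : cstarAlgType R) (a : A) :=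
  forall S : {pred A}, GRing.subalg_closed S ->
    (forall x, x \in S -> star x \in S) -> cnorm_closed S ->
    a \in S -> forall x, x \in S.

Definition star_hom (A B : cstarAlgType R) (phi : {lrmorphism A -> B}) :=
  {morph phi : x / star x}.

Definition universal_q_algebra (A : cstarAlgType R) (a : A) :=
  [/\ q_relation a, cstar_generated a &
    forall (B : cstarAlgType R) (b : B), q_relation b ->
      exists phi : {lrmorphism A -> B}, [/\ star_hom phi, phi a = b &
        forall psi : {lrmorphism A -> B}, star_hom psi -> psi a = b ->
          psi =1 phi]].

End UniversalAlgebra.

Section Operators.
Context (R : realType) (H : hilbertType R).

Record bounded_op := BoundedOp {
  op_fun :> {linear H -> H} ;
  op_bounded : exists M : R, forall u, `|op_fun u| <= M%:C * `|u|
}.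

Implicit Types S T : bounded_op.

Definition is_adjoint S T := forall u v, dotp (S u) v = dotp u (T v).

Definition commutant (X : set bounded_op) : set bounded_op :=
  [set T | forall S, X S -> forall u, T (S u) = S (T u)].

Definition bicommutant (X : set bounded_op) := commutant (commutant X).

(* M = M'' makes M a unital subalgebra. *)
Definition is_von_neumann (M : set bounded_op) :=
  (forall S T, M S -> is_adjoint S T -> M T) /\ bicommutant M = M.

Definition von_neumann_generated (X : set bounded_op) : set bounded_op :=
  \bigcap_(M in [set M | is_von_neumann M /\ X `<=` M]) M.

Definition scalar_ops : set bounded_op :=
  [set T | exists c : R[i], forall u, T u = c *: u].

Record unital_star_rep (A : cstarAlgType R) (pi : A -> bounded_op) : Prop := {
  star_rep_linear : forall c x y u, pi (c *: x + y) u = c *: pi x u + pi y u ;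
  star_rep_mul : forall x y u, pi (x * y) u = pi x (pi y u) ;
  star_rep_one : forall u, pi 1 u = u ;
  star_rep_star : forall x, is_adjoint (pi x) (pi (star x))
}.

Definition tail_algebra (A : cstarAlgType R) (iota : int -> A -> bounded_op) :
    set bounded_op :=
  \bigcap_(I in [set I : set int | finite_set I])
    bicommutant (\bigcup_(K in [set K | finite_set K /\ K `&` I = set0])
      von_neumann_generated (\bigcup_(k in K) range (iota k))).

End Operators.

Section QFock.
Context (R : realType).

Definition inversions n (p : 'S_n) : nat :=
  #|[pred ij : 'I_n * 'I_n | (ij.1 < ij.2)%N && (p ij.2 < p ij.1)%N]|.

Definition q_inner (q : R) (H : hilbertType R) (s t : seq H) : R[i] :=
  if size s == size t then
    \sum_(p : 'S_(size s)) (q ^+ inversions p)%:C *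
      \prod_(i < size s) dotp s`_i t`_(p i)
  else 0.

(* A completion of the algebraic q-Fock space over H, determined up to unitary
   equivalence. [fock_tensor [:: f_1; ..; f_n]] is f_1 (x) .. (x) f_n and
   [fock_tensor [::]] is the vacuum. Multilinearity of fock_tensor follows from
   fock_dot, since the difference of the two sides has norm 0. *)
Record q_fock (q : R) (H : hilbertType R) := QFock {
  fock_space :> hilbertType R ;
  fock_tensor : seq H -> fock_space ;
  fock_dot : forall s t, dotp (fock_tensor s) (fock_tensor t) = q_inner q s t ;
  fock_dense : closure [set u | exists n (c : 'I_n -> R[i]) (s : 'I_n -> seq H),
    u = \sum_i c i *: fock_tensor (s i)] = [set: fock_space]
}.

(* With 0-based positions the factor q^(k-1) becomes q^k; on the vacuum the sum
   is empty. *)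
Definition is_annihilator (q : R) (H : hilbertType R) (G : q_fock q H) (f : H)
    (l : bounded_op G) :=
  forall s : seq H, l (fock_tensor G s) =
    \sum_(k < size s) ((q ^+ k)%:C * dotp s`_k f) *:
      fock_tensor G (take k s ++ drop k.+1 s).

End QFock.

(* Sums over int are taken as limits of the sums over [-n, n-1]; they are only
   used for absolutely convergent families. *)
Definition zpsum (R : realType) (g : int -> R) : R^nat :=
  series (fun k : nat => g (Posz k) + g (Negz k)).
Definition zsum (R : realType) (g : int -> R) : R := limn (zpsum g).
Definition zcsum (R : realType) (f : int -> R[i]) : R[i] :=
  zsum (fun k => complex.Re (f k)) +i* zsum (fun k => complex.Im (f k)).
Definition sqmod (R : realType) (z : R[i]) : R :=
  complex.Re z ^+ 2 + complex.Im z ^+ 2.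

Section ZSum.
Context (R : realType).
Implicit Types (g h : int -> R).

Lemma zpsumD g h : zpsum (g \+ h) = zpsum g \+ zpsum h.
Proof.
apply/funext => n; rewrite /zpsum /series/= -big_split/=.
by apply: eq_bigr => k _; rewrite addrACA.
Qed.

Lemma zpsumZ c g : zpsum (fun k => c * g k) = (fun n => c * zpsum g n).
Proof.
apply/funext => n; rewrite /zpsum /series/= mulr_sumr.
by apply: eq_bigr => k _; rewrite mulrDr.
Qed.

Lemma is_cvg_zpsumD g h :
  cvgn (zpsum g) -> cvgn (zpsum h) -> cvgn (zpsum (g \+ h)).
Proof. by move=> cg ch; rewrite zpsumD; exact: is_cvgD. Qed.

Lemma is_cvg_zpsumZ c g : cvgn (zpsum g) -> cvgn (zpsum (fun k => c * g k)).
Proof. by move=> cg; rewrite zpsumZ; exact: is_cvgMr. Qed.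

Lemma zsumD g h : cvgn (zpsum g) -> cvgn (zpsum h) ->
  zsum (g \+ h) = zsum g + zsum h.
Proof. by move=> cg ch; rewrite /zsum zpsumD; exact: limD. Qed.

Lemma zsumZ c g : cvgn (zpsum g) -> zsum (fun k => c * g k) = c * zsum g.
Proof. by move=> cg; rewrite /zsum zpsumZ; apply/cvg_lim => //; exact: cvgMr. Qed.

Lemma is_cvg_zpsum_le g h :
  (forall k, `|g k| <= h k) -> cvgn (zpsum h) -> cvgn (zpsum g).
Proof.
move=> gh ch; apply: normed_cvg.
apply: (@series_le_cvg _ _ (fun k : nat => h (Posz k) + h (Negz k))) => //= n.
  by rewrite addr_ge0// (le_trans _ (gh _)).
by rewrite (le_trans (ler_normD _ _))// lerD.
Qed.

Lemma zpsum_homo g : (forall k, 0 <= g k) ->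
  {homo zpsum g : n m / (n <= m)%N >-> n <= m}.
Proof.
move=> g0 n m nm; rewrite /zpsum /series/=.
by rewrite (big_cat_nat _ nm)//= lerDl sumr_ge0// => k _; rewrite addr_ge0.
Qed.

Lemma is_cvg_zpsum_bounded g M : (forall k, 0 <= g k) ->
  (forall n, zpsum g n <= M) -> cvgn (zpsum g).
Proof.
move=> g0 gM; apply: nondecreasing_is_cvgn; first exact: zpsum_homo.
by exists M => _ [n _ <-].
Qed.

Lemma zpsum_le_zsum g n : (forall k, 0 <= g k) -> cvgn (zpsum g) ->
  zpsum g n <= zsum g.
Proof. by move=> g0 cg; apply: nondecreasing_cvgn_le => //; exact: zpsum_homo. Qed.

Lemma zsum_le g M : (forall k, 0 <= g k) -> cvgn (zpsum g) ->
  (forall n, zpsum g n <= M) -> zsum g <= M.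
Proof. by move=> g0 cg gM; apply: limr_le => //; exact: nearW. Qed.

Lemma le_zsum g k : (forall k, 0 <= g k) -> cvgn (zpsum g) -> g k <= zsum g.
Proof.
move=> g0 cg; pose n := (match k with Posz n => n | Negz n => n end).
apply: le_trans (zpsum_le_zsum n.+1 g0 cg).
rewrite /zpsum /series/= big_nat_recr//= ler_wpDl//.
  by rewrite sumr_ge0// => i _; rewrite addr_ge0.
by rewrite /n; case: k {n} => n; rewrite ?lerDl ?lerDr.
Qed.

End ZSum.

Section DotNorm.
Context (C : numClosedFieldType) (U : lmodType C) (form : {dot U for Num.conj}).
Let nrm u := sqrtC (form u u).

Lemma dot_cauchy_schwarz u v : `|form u v| <= nrm u * nrm v.
Proof.
have [->|v0] := eqVneq v 0.
  by rewrite linear0r normr0 mulr_ge0// sqrt_dnorm_ge0.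
have vv0 : form v v != 0 by rewrite dnorm_eq0.
rewrite -(@ler_pXn2r _ 2)// ?nnegrE ?mulr_ge0 ?sqrt_dnorm_ge0//.
rewrite exprMn !sqrtCK.
pose a := form u v / form v v; pose w := u - a *: v.
have wv : form w v = 0 by rewrite linearBl/= linearZl_LR/= divfK// subrr.
have -> : form u v = a * form v v by rewrite divfK.
rewrite normrM exprMn (ger0_norm (dnorm_ge0 _ _)) expr2 mulrA.
rewrite ler_wpM2r ?dnorm_ge0//.
have -> : u = w + a *: v by rewrite subrK.
rewrite hnormDd/=; last by rewrite linearZr_LR/= wv mulr0.
by rewrite dnormZ lerDr dnorm_ge0.
Qed.

Lemma dot_triangle u v : nrm (u + v) <= nrm u + nrm v.
Proof.
rewrite -(@ler_pXn2r _ 2)// ?nnegrE ?addr_ge0 ?sqrt_dnorm_ge0//.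
rewrite sqrrD !sqrtCK dnormD/= addrAC lerD2r lerD2l.
apply: le_trans (_ : `|form u v| *+ 2 <= _); last first.
  by rewrite ler_wMn2r// dot_cauchy_schwarz.
rewrite (le_trans (real_ler_norm _))//.
  by rewrite CrealE rmorphD/= conjCK addrC.
by rewrite (le_trans (ler_normD _ _))// norm_conjC.
Qed.

Lemma dot_normZ c u : nrm (c *: u) = `|c| * nrm u.
Proof. by rewrite /nrm dnormZ sqrtCM ?nnegrE ?dnorm_ge0 ?exprn_ge0// sqrCK. Qed.

Lemma dot_norm0_eq0 u : nrm u = 0 -> u = 0.
Proof. by move=> /eqP; rewrite sqrt_dnorm_eq0 => /eqP. Qed.

End DotNorm.

Section Sqmod.
Context (R : realType).
Implicit Types (z w : R[i]).

Lemma sqmod_ge0 z : 0 <= sqmod z.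
Proof. by rewrite addr_ge0 ?sqr_ge0. Qed.

Lemma sqmod_eq0 z : sqmod z = 0 -> z = 0.
Proof.
move=> /eqP; rewrite paddr_eq0 ?sqr_ge0// !sqrf_eq0 => /andP[/eqP a /eqP b].
by case: z a b => x y /= -> ->.
Qed.

Lemma sqmodM z w : sqmod (z * w) = sqmod z * sqmod w.
Proof. by case: z w => [a b] [c d]; rewrite /sqmod/=; ring. Qed.

Lemma sqmodD_le z w : sqmod (z + w) <= 2 * sqmod z + 2 * sqmod w.
Proof. case: z w => [a b] [c d]; rewrite /sqmod/=.
have := sqr_ge0 (a - c); have := sqr_ge0 (b - d); nra. Qed.

Lemma mulCJ z w : z * w^* = (complex.Re z * complex.Re w + complex.Im z * complex.Im w)
  +i* (complex.Im z * complex.Re w - complex.Re z * complex.Im w).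
Proof. by case: z w => [a b] [c d]; apply/eqP; rewrite eq_complex/=; apply/andP; split; apply/eqP; ring. Qed.

Lemma normr_Re_mulCJ z w : `|complex.Re (z * w^*)| <= sqmod z + sqmod w.
Proof.
rewrite mulCJ; case: z w => [a b] [c d]; rewrite /sqmod/= ler_norml.
have := sqr_ge0 (a - c); have := sqr_ge0 (b - d).
have := sqr_ge0 (a + c); have := sqr_ge0 (b + d).
by move=> *; apply/andP; split; nra.
Qed.

Lemma normr_Im_mulCJ z w : `|complex.Im (z * w^*)| <= sqmod z + sqmod w.
Proof.
rewrite mulCJ; case: z w => [a b] [c d]; rewrite /sqmod/= ler_norml.
have := sqr_ge0 (b - c); have := sqr_ge0 (a - d).
have := sqr_ge0 (b + c); have := sqr_ge0 (a + d).
by move=> *; apply/andP; split; nra.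
Qed.

End Sqmod.

Section CSum.
Context (R : realType).
Implicit Types (a b : int -> R[i]).

Definition zccvg a := cvgn (zpsum (fun k => complex.Re (a k))) /\
  cvgn (zpsum (fun k => complex.Im (a k))).

Lemma ReD (z w : R[i]) : complex.Re (z + w) = complex.Re z + complex.Re w.
Proof. by case: z; case: w. Qed.
Lemma ImD (z w : R[i]) : complex.Im (z + w) = complex.Im z + complex.Im w.
Proof. by case: z; case: w. Qed.

Lemma zcsumD a b : zccvg a -> zccvg b ->
  zcsum (fun k => a k + b k) = zcsum a + zcsum b.
Proof.
move=> [ra ia] [rb ib]; rewrite /zcsum.
under [X in zsum X]eq_fun do rewrite ReD.
under [X in _ +i* zsum X]eq_fun do rewrite ImD.
by rewrite !zsumD.
Qed.

Lemma zcsumZ (c : R[i]) a : zccvg a -> zcsum (fun k => c * a k) = c * zcsum a.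
Proof.
case: c => x y [ra ia]; rewrite /zcsum.
have -> : (fun k => complex.Re ((x +i* y) * a k)) =
  (fun k => x * complex.Re (a k)) \+ (fun k => - y * complex.Im (a k)).
  by apply/funext => k /=; case: (a k) => ? ? /=; rewrite mulNr.
have -> : (fun k => complex.Im ((x +i* y) * a k)) =
  (fun k => x * complex.Im (a k)) \+ (fun k => y * complex.Re (a k)).
  by apply/funext => k /=; case: (a k).
rewrite !zsumD ?zsumZ//; try exact: is_cvg_zpsumZ.
by apply/eqP; rewrite eq_complex/=; apply/andP; split; apply/eqP; ring.
Qed.

Lemma zcsumJ a : zccvg a -> zcsum (fun k => (a k)^* ) = (zcsum a)^*.
Proof.
move=> [ra ia]; rewrite /zcsum.
have -> : (fun k => complex.Re (a k)^*) = (fun k => complex.Re (a k)).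
  by apply/funext => k; case: (a k).
have -> : (fun k => complex.Im (a k)^*) = (fun k => -1 * complex.Im (a k)).
  by apply/funext => k; case: (a k) => ? ? /=; rewrite mulN1r.
by rewrite zsumZ// mulN1r.
Qed.

End CSum.

(* The square-summable families l^2(Z). *)
Definition l2_pred (R : realType) : {pred (int -> R[i])} :=
  [pred f | `[< cvgn (zpsum (fun k => sqmod (f k))) >]].
Record l2 (R : realType) := L2 { l2_fun :> int -> R[i]; l2P : l2_fun \in @l2_pred R }.

HB.instance Definition _ (R : realType) := [isSub for @l2_fun R].
HB.instance Definition _ (R : realType) := [Choice of l2 R by <:].

Section l2_lmod.
Context (R : realType).

Lemma l2_cvg (f : l2 R) : cvgn (zpsum (fun k => sqmod (f k))).
Proof. by have /asboolP := l2P f. Qed.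

Lemma l2_submod_closed : GRing.subsemimod_closed (@l2_pred R).
Proof.
split; first split.
- apply/asboolP; apply: (@is_cvg_zpsum_bounded _ _ 0) => [k|n].
    exact: sqmod_ge0.
  by rewrite /zpsum /series/= big1// => k _; rewrite /sqmod/=; ring.
- move=> f g /asboolP cf /asboolP cg; apply/asboolP.
  apply: (@is_cvg_zpsum_le _ _ ((fun k => 2 * sqmod (f k)) \+ (fun k => 2 * sqmod (g k)))).
    by move=> k; rewrite ger0_norm ?sqmod_ge0//; exact: sqmodD_le.
  by apply: is_cvg_zpsumD; exact: is_cvg_zpsumZ.
- move=> c f /asboolP cf; apply/asboolP.
  have -> : (fun k => sqmod ((c *: f) k)) = (fun k => sqmod c * sqmod (f k)).
    by apply/funext => k; rewrite -sqmodM.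
  exact: is_cvg_zpsumZ.
Qed.

HB.instance Definition _ := GRing.SubChoice_isSubLmodule.Build R[i] (int -> R[i])
  (@l2_pred R) (l2 R) l2_submod_closed.
End l2_lmod.

Definition l2_dot (R : realType) (f g : l2 R) : R[i] :=
  zcsum (fun k => f k * (g k)^*).

Section l2_dot.
Context (R : realType).
Implicit Types (f g h : l2 R).

Lemma l2_dot_cvg f g : zccvg (fun k => f k * (g k)^*).
Proof.
have cfg : cvgn (zpsum ((fun k => sqmod (f k)) \+ (fun k => sqmod (g k)))).
  by apply: is_cvg_zpsumD; exact: l2_cvg.
split; apply: is_cvg_zpsum_le cfg => k /=.
  exact: normr_Re_mulCJ.
exact: normr_Im_mulCJ.
Qed.

Let dot_linear g : GRing.linear_for *%R ((@l2_dot R) ^~ g).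
Proof.
move=> c f h; rewrite /l2_dot -zcsumZ; last exact: l2_dot_cvg.
rewrite -zcsumD; last 2 first.
- have [a b] := l2_dot_cvg (c *: f) g.
  by split; [move: a|move: b]; under eq_fun do rewrite /= -mulrA.
- exact: l2_dot_cvg.
by congr zcsum; apply/funext => k /=; rewrite mulrDl mulrA.
Qed.

Let dot_sym f g : l2_dot f g = (-1) ^+ false * (l2_dot g f)^*.
Proof.
rewrite expr0 mul1r /l2_dot -zcsumJ; last exact: l2_dot_cvg.
by congr zcsum; apply/funext => k; rewrite rmorphM/= conjCK mulrC.
Qed.

Let dot_linearr f : GRing.linear_for (Num.conj \; *%R) (@l2_dot R f).
Proof.
move=> c g h; rewrite dot_sym dot_linear [l2_dot f g]dot_sym [l2_dot f h]dot_sym.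
by rewrite !expr0 !mul1r rmorphD rmorphM.
Qed.

Lemma l2_dotE f : l2_dot f f = (zsum (fun k => sqmod (f k)))%:C.
Proof.
rewrite /l2_dot /zcsum; congr (_ +i* _).
  by congr zsum; apply/funext => k; rewrite mulCJ/= /sqmod !expr2.
rewrite [X in zsum X](_ : _ = fun k => 0 * sqmod (f k)).
  by rewrite zsumZ ?mul0r//; exact: l2_cvg.
by apply/funext => k; rewrite mulCJ/= mul0r mulrC subrr.
Qed.

Let dot_gt0 f : f != 0 -> 0 < l2_dot f f.
Proof.
move=> f0; rewrite l2_dotE ltcR lt_neqAle eq_sym andbC.
have s0 k : 0 <= sqmod (f k) by exact: sqmod_ge0.
rewrite (le_trans (s0 0) (le_zsum 0 s0 (@l2_cvg R f)))//=.
apply: contra f0 => /eqP z0; apply/eqP/val_inj/funext => k /=.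
apply: sqmod_eq0; apply/eqP; rewrite eq_le s0 andbT -z0.
exact: (le_zsum k s0 (@l2_cvg R f)).
Qed.

HB.instance Definition _ := bilinear_isBilinear.Build R[i] (l2 R) (l2 R) R[i]
  *%R (Num.conj \; *%R) (@l2_dot R) (dot_linear, dot_linearr).
HB.instance Definition _ := isHermitianSesquilinear.Build R[i] (l2 R) false
  Num.conj (@l2_dot R) dot_sym.
HB.instance Definition _ := isDotProduct.Build R[i] (l2 R) (@l2_dot R) dot_gt0.

HB.instance Definition _ := Lmodule_isNormed.Build R[i] (l2 R)
  (dot_triangle (@l2_dot R)) (dot_normZ (@l2_dot R)) (@dot_norm0_eq0 _ _ (@l2_dot R)).

End l2_dot.
Section l2_complete.
Context (R : realType).
Implicit Types (f g h : l2 R).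

Lemma l2_normE f : `|f| ^+ 2 = (zsum (fun k => sqmod (f k)))%:C.
Proof. by rewrite -l2_dotE -[RHS]sqrtCK. Qed.

Lemma l2_norm_lt f (e : R) : 0 < e -> `|f| < e%:C ->
  zsum (fun k => sqmod (f k)) <= e ^+ 2.
Proof.
move=> e0 fe; rewrite -lecR -l2_normE (_ : (e ^+ 2)%:C = e%:C ^+ 2); last first.
  by rewrite rmorphXn.
by rewrite ler_pXn2r ?nnegrE// ?ler0c ltW.
Qed.

Lemma l2_norm_le f (e : R) : 0 <= e -> zsum (fun k => sqmod (f k)) <= e ^+ 2 ->
  `|f| <= e%:C.
Proof.
move=> e0 fe; rewrite -(@ler_pXn2r _ 2)// ?nnegrE ?ler0c//.
by rewrite l2_normE -rmorphXn/= lecR.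
Qed.

Lemma l2_complete (F : set_system (l2 R)) : ProperFilter F -> cauchy F -> cvg F.
Proof.
move=> FF /cauchyP cF.
have {}cF (e : R) : 0 < e -> exists2 x : l2 R,
    F [set f | `|x - f| < e%:C] & F [set f | zsum (fun k => sqmod ((x - f) k)) <= e ^+ 2].
  move=> e0; have [|x Fx] := cF e%:C; first by rewrite ltcR.
  have Fx' : F [set f | `|x - f| < e%:C] by rewrite -ball_normE in Fx.
  by exists x => //; apply: filterS Fx' => f; exact: l2_norm_lt.
have cRe k : cvg ((fun f => complex.Re (f k)) @ F).
  apply/cauchy_cvgP/cauchyP => e e0.
  have [|x _ Fx] := cF (e / 2); first by rewrite divr_gt0.
  exists (complex.Re (x k)).
  suff: F [set f : l2 R | ball (complex.Re (x k)) e (complex.Re (f k))] by [].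
  apply: filterS Fx => f /= xf.
  rewrite -ball_normE/=.
  have := le_trans (le_zsum k (fun k => sqmod_ge0 _) (@l2_cvg R (x - f))) xf.
  rewrite /sqmod -[(x - f) k]/(x k - f k); case: (x k) (f k) => [a b] [c d]/= le.
  rewrite -(@ltr_pXn2r _ 2)// ?nnegrE// ?ltW// real_normK ?num_real//.
  have := sqr_ge0 (b - d); nra.
have cIm k : cvg ((fun f => complex.Im (f k)) @ F).
  apply/cauchy_cvgP/cauchyP => e e0.
  have [|x _ Fx] := cF (e / 2); first by rewrite divr_gt0.
  exists (complex.Im (x k)).
  suff: F [set f : l2 R | ball (complex.Im (x k)) e (complex.Im (f k))] by [].
  apply: filterS Fx => f /= xf.
  rewrite -ball_normE/=.
  have := le_trans (le_zsum k (fun k => sqmod_ge0 _) (@l2_cvg R (x - f))) xf.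
  rewrite /sqmod -[(x - f) k]/(x k - f k); case: (x k) (f k) => [a b] [c d]/= le.
  rewrite -(@ltr_pXn2r _ 2)// ?nnegrE// ?ltW// real_normK ?num_real//.
  have := sqr_ge0 (a - c); nra.
pose g : int -> R[i] := fun k => lim ((fun f => complex.Re (f k)) @ F) +i*
  lim ((fun f => complex.Im (f k)) @ F).
have gle (e : R) (x : l2 R) : F [set f | zsum (fun k => sqmod ((x - f) k)) <= e ^+ 2] ->
    forall n, zpsum (fun k => sqmod (x k - g k)) n <= e ^+ 2.
  move=> Fx n.
  have sq k : (fun f : l2 R => sqmod (x k - f k)) @ F --> sqmod (x k - g k).
    rewrite /sqmod !ReD !ImD /g; under eq_fun do rewrite ReD ImD.
    have cR : (fun f : l2 R => complex.Re (x k) + complex.Re (- f k)) @ F -->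
        complex.Re (x k) + complex.Re (- g k).
      apply: cvgD; first exact: cvg_cst.
      rewrite (_ : (fun _ => _) = (fun f : l2 R => - complex.Re (f k))); last first.
        by apply/funext => f; case: (f k).
      exact: cvgN.
    have cI : (fun f : l2 R => complex.Im (x k) + complex.Im (- f k)) @ F -->
        complex.Im (x k) + complex.Im (- g k).
      apply: cvgD; first exact: cvg_cst.
      rewrite (_ : (fun _ => _) = (fun f : l2 R => - complex.Im (f k))); last first.
        by apply/funext => f; case: (f k).
      exact: cvgN.
    by apply: cvgD; rewrite !expr2; apply: cvgM.
  have cn : (fun f : l2 R => zpsum (fun k => sqmod (x k - f k)) n) @ F -->
      zpsum (fun k => sqmod (x k - g k)) n.
    apply: cvg_big => [|k _]; first exact: add_continuous.
    by apply: cvgD; exact: sq.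
  rewrite -(cvg_lim _ cn)//; apply: limr_le; first by apply/cvg_ex; eexists; exact: cn.
  apply: filterS Fx => f; apply: le_trans.
  by apply: (@zpsum_le_zsum _ _ n _ (@l2_cvg R (x - f))) => k; exact: sqmod_ge0.
have dl2 (e : R) (x : l2 R) : F [set f | zsum (fun k => sqmod ((x - f) k)) <= e ^+ 2] ->
    (fun k => x k - g k) \in @l2_pred R.
  move=> Fx; apply/asboolP; apply: is_cvg_zpsum_bounded (gle _ _ Fx) => k.
  exact: sqmod_ge0.
have [x _ Fx] := cF 1 ltr01.
have gl2 : g \in @l2_pred R.
  have -> : g = \val (x - L2 (dl2 _ _ Fx)).
    by apply/funext => k; rewrite -[RHS]/(x k - (x k - g k)) opprB addrC subrK.
  exact: l2P.
apply/cvg_ex; exists (L2 gl2); apply/cvgrPdist_lt => e.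
rewrite ltcE/= => /andP[/eqP ei er].
have -> : e = (complex.Re e)%:C by case: e ei {er} => ? ? /= ->.
have [|y Fy1 Fy2] := cF (complex.Re e / 2); first by rewrite divr_gt0.
have yg : `|y - L2 gl2| <= (complex.Re e / 2)%:C.
  apply: l2_norm_le; first by rewrite ltW// divr_gt0.
  apply: zsum_le (gle _ _ Fy2); first by move=> k; exact: sqmod_ge0.
  exact: (@l2_cvg R (y - L2 gl2)).
apply: filterS Fy1 => f /= yf.
rewrite -(subrK y (L2 gl2)) -addrA (le_lt_trans (ler_normD _ _))//.
by rewrite distrC [complex.Re e]splitr rmorphD/= ler_ltD.
Qed.

HB.instance Definition _ := Uniform_isComplete.Build (l2 R) l2_complete.

Let l2_dot_norm f : `|f| ^+ 2 = (@l2_dot R : {dot (l2 R) for Num.conj}) f f.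
Proof. by rewrite l2_normE -l2_dotE. Qed.

HB.instance Definition _ :=
  NormedModule_hasDot.Build R (l2 R) l2_dot_norm.
End l2_complete.

Section l2_basis.
Context (R : realType).

Lemma l2_basis_subproof (j : int) :
  (fun k => (k == j)%:R : R[i]) \in @l2_pred R.
Proof.
have sq k : sqmod ((k == j)%:R : R[i]) = (k == j)%:R :> R.
  by case: (k == j); rewrite /sqmod/= ?expr0n ?expr1n ?addr0.
apply/asboolP; apply: (@is_cvg_zpsum_bounded _ _ 1) => [k|n].
  exact: sqmod_ge0.
pose m := match j with Posz m => m | Negz m => m end.
suff -> : zpsum (fun k => sqmod ((k == j)%:R : R[i])) n = (m < n)%:R.
  by rewrite lern1 leq_b1.
rewrite /zpsum /series/=; under eq_bigr do rewrite !sq.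
elim: n => [|n IH]; first by rewrite big_nil.
rewrite big_nat_recr//= IH -!natrD; congr (_%:R).
have -> : ((Posz n == j) + (Negz n == j) = (n == m))%N.
  rewrite /m; case: j {sq m IH} => p.
    have -> : (Posz n == Posz p) = (n == p) by apply/eqP/eqP => [[]|->].
    by rewrite (_ : (Negz n == Posz p) = false)// addn0.
  have -> : (Negz n == Negz p) = (n == p) by apply/eqP/eqP => [[]|->].
  by rewrite (_ : (Posz n == Negz p) = false).
rewrite ltnS (leq_eqVlt m n) [n == m]eq_sym.
have [->|_] := eqVneq m n; first by rewrite ltnn.
by rewrite addn0.
Qed.

Definition l2_basis (j : int) : l2 R := L2 (l2_basis_subproof j).

End l2_basis.

(* Main.v *)
Require Import Defs.
From HB Require Import structures.
From mathcomp Require Import all_boot all_order all_algebra all_fingroup.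
From mathcomp Require Import complex ring lra zify.
From mathcomp Require Import all_classical all_reals all_analysis.

Set Implicit Arguments.
Unset Strict Implicit.
Unset Printing Implicit Defensive.

Import Order.TTheory GRing.Theory Num.Theory.
Import numFieldNormedType.Exports.

Local Open Scope classical_set_scope.
Local Open Scope ring_scope.

(** The operators that commute with annihilation and creation on the left are
those that act on the right. For a unit vector e_j let r_j^+ be the right
creator f_1 (x) .. (x) f_n |-> f_1 (x) .. (x) f_n (x) e_j and r_j its adjoint.
In l_k (f_1 (x) .. (x) f_n (x) e_j) the only term that sees the new factor is
q^n <e_j, e_k> f_1 (x) .. (x) f_n, which vanishes for k != j; so r_j^+ commutes
with l_k, with the left creator l_k^+, and then with all of iota_k(A) when
k != j. Taking I = {j} in the definition of the tail algebra, every tail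
operator T commutes with r_j and r_j^+, and this holds for every j in Z.

This forces T to be a scalar. First, r_j T vac = T r_j vac = 0 for all j, so
T vac is orthogonal to every f_1 (x) .. (x) f_n (x) e_j; such tensors span a
dense subspace of the orthogonal complement of the vacuum, whence T vac = c vac.
Second, T (s (x) e_j) = T r_j^+ s = r_j^+ T s, so T = c propagates by induction
on the length of the tensors ([right_commutant_scalar]).

Three points need an argument.
- Boundedness of r_j^+. The flip f_1 (x) .. (x) f_n |-> f_n (x) .. (x) f_1
  preserves the q-inner product, because conjugating a permutation by the
  order-reversing one keeps the number of inversions ([q_inner_rev]). It
  therefore extends to a bounded self-adjoint operator F
  ([isometry_extension]), and r_j = F l_j F is bounded because l_j is.
- The adjoint of l_j is the left creator. This is the expansion of the
  q-inner product along the first factor of its second argument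
  ([q_inner_cons]).
- From the generator a to all of A. The elements of A that are represented by
  operators commuting with r_j and r_j^+ form a *-subalgebra containing a; it
  is closed because a *-representation of a C*-algebra is continuous
  ([rep_contraction]), which follows from the existence of square roots of
  1 - h for small self-adjoint h ([cnorm_self_adjoint_sqrt]). *)

(** * Hilbert spaces and bounded operators *)

Section Hilbert.
Context (R : realType) (H : hilbertType R).
Implicit Types u v : H.

Lemma hilbert_normE u : `|u| = sqrtC (dotp u u).
Proof. by rewrite -dotp_norm sqrCK. Qed.

Lemma hilbert_cauchy_schwarz u v : `|dotp u v| <= `|u| * `|v|.
Proof. by rewrite !hilbert_normE dot_cauchy_schwarz. Qed.

Lemma dotpC u v : dotp u v = (dotp v u)^*.
Proof. by rewrite hermC expr0 mul1r. Qed.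

Lemma dotp_inj u w : (forall v, dotp u v = dotp w v) -> u = w.
Proof.
move=> uw; apply/eqP; rewrite -subr_eq0 -(dnorm_eq0 (@dotp R H)).
by rewrite linearBl/= uw subrr.
Qed.

Lemma adjoint_sym (S T : bounded_op H) : is_adjoint S T -> is_adjoint T S.
Proof. by move=> ST u v; rewrite dotpC -ST -dotpC. Qed.

Lemma op_bounded_ge0 (T : bounded_op H) :
  exists2 M : R[i], 0 <= M & forall u, `|T u| <= M * `|u|.
Proof.
have [M TM] := op_bounded T; exists `|M%:C| => // u.
rewrite (le_trans (TM u))// ler_wpM2r// real_ler_norm//.
by rewrite complex_real.
Qed.

Lemma op_comp_bounded (S T : bounded_op H) :
  exists M : R, forall u, `|(S \o T) u| <= M%:C * `|u|.
Proof.
have [M SM] := op_bounded S; have [N TN] := op_bounded T.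
exists (Num.max M 0 * N) => u /=; rewrite rmorphM -mulrA.
apply: le_trans (SM _) _; apply: (@le_trans _ _ ((Num.max M 0)%:C * `|T u|)).
  by rewrite ler_wpM2r// lecR le_max lexx.
by rewrite ler_wpM2l// ler0c le_max lexx orbT.
Qed.

Definition op_comp (S T : bounded_op H) : bounded_op H :=
  BoundedOp (op_comp_bounded S T).

End Hilbert.

Section SmallBounds.
Context (R : realType).
Implicit Types x M : R[i].

(** Closes the density arguments below: the bound M is fixed and the
approximation error e is arbitrary. *)
Lemma le_small M x : 0 <= M -> (forall e, 0 < e -> x <= M * e) -> x <= 0.
Proof.
move=> M0 xM; apply/ler_addgt0Pr => e e0.
have M1 : 0 < M + 1 by rewrite ltr_wpDl.
apply: le_trans (xM (e / (M + 1)) _) _; first by rewrite divr_gt0.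
by rewrite add0r mulrCA ger_pMr// ler_pdivrMr// mul1r lerDl.
Qed.

Lemma norm_small_eq0 (V : normedModType R[i]) M (u : V) : 0 <= M ->
  (forall e, 0 < e -> `|u| <= M * e) -> u = 0.
Proof.
move=> M0 uM; apply/normr0_eq0/le_anti; rewrite normr_ge0 andbT.
exact: le_small uM.
Qed.

End SmallBounds.

(** * Total families and extension of isometries *)

Section IsometryExtension.
Context (R : realType) (H : hilbertType R) (I : Type).
Implicit Types (v w : I -> H) (x : seq (R[i] * I)).

(** The combination is indexed by a sequence of coefficient-index pairs, so that
a sum of combinations is a concatenation. *)
Definition lin_comb v x : H := \sum_(p <- x) p.1 *: v p.2.

Lemma lin_combD v x y : lin_comb v (x ++ y) = lin_comb v x + lin_comb v y.
Proof. exact: big_cat. Qed.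

Lemma lin_combZ v (c : R[i]) x :
  lin_comb v [seq (c * p.1, p.2) | p <- x] = c *: lin_comb v x.
Proof.
rewrite /lin_comb big_map scaler_sumr.
by apply: eq_bigr => p _; rewrite scalerA.
Qed.

Lemma lin_comb1 v i : lin_comb v [:: (1, i)] = v i.
Proof. by rewrite /lin_comb big_seq1 scale1r. Qed.

Definition total v := forall (u : H) (e : R[i]), 0 < e ->
  exists x, `|u - lin_comb v x| < e.

Section TotalFamily.
Context (v : I -> H) (tot_v : total v).

(** A bounded linear map is determined by its values on a total family; all the
identities on Fock space below are reduced to elementary tensors this way. *)
Lemma total_linear_eq0 (V : normedModType R[i]) (phi : H -> V) (M : R[i]) :
  linear phi -> 0 <= M -> (forall u, `|phi u| <= M * `|u|) ->
  (forall i, phi (v i) = 0) -> forall u, phi u = 0.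
Proof.
move=> lphi M0 phiM phi0 u.
pose L : {linear H -> V} := HB.pack phi (GRing.isLinear.Build _ _ _ _ phi lphi).
apply: (norm_small_eq0 M0) => e e0; have [x ux] := tot_v u e0.
have -> : phi u = L (u - lin_comb v x).
  rewrite linearB [X in _ - X](_ : _ = 0) ?subr0// linear_sum big1// => p _.
  by rewrite linearZ_LR [L _]phi0 scaler0.
by rewrite (le_trans (phiM _))// ler_wpM2l// ltW.
Qed.

Lemma total_op_eq (S T : bounded_op H) : (forall i, S (v i) = T (v i)) ->
  forall u, S u = T u.
Proof.
move=> ST u; have [M M0 SM] := op_bounded_ge0 S; have [N N0 TN] := op_bounded_ge0 T.
apply/eqP; rewrite -subr_eq0; apply/eqP.
apply: (@total_linear_eq0 _ (fun u => S u - T u) (M + N)) => [c x y||x|i] /=.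
- by rewrite (linearP S) (linearP T) scalerBr opprD addrACA.
- exact: addr_ge0.
- by rewrite (le_trans (ler_normB _ _))// mulrDl lerD.
- by rewrite ST subrr.
Qed.

Lemma total_dotp_eq (S : bounded_op H) (w w' : H) :
  (forall i, dotp (S (v i)) w = dotp (v i) w') ->
  forall u, dotp (S u) w = dotp u w'.
Proof.
move=> Sw u; have [M M0 SM] := op_bounded_ge0 S.
apply/eqP; rewrite -subr_eq0; apply/eqP.
apply: (@total_linear_eq0 (R[i]^o) (fun u => dotp (S u) w - dotp u w')
  (M * `|w| + `|w'|)) => [c x y||x|i].
- by rewrite (linearP S) !linearPl/= opprD addrACA -mulrBr.
- by rewrite addr_ge0// mulr_ge0.
- rewrite (le_trans (ler_normB _ _))// mulrDl lerD//.
    by rewrite (le_trans (hilbert_cauchy_schwarz _ _))// mulrAC ler_wpM2r.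
  by rewrite (le_trans (hilbert_cauchy_schwarz _ _))// mulrC.
- by rewrite Sw subrr.
Qed.

(** The density argument is applied to one argument of the inner product at a
time. *)
Lemma total_adjoint (S T : bounded_op H) :
  (forall i j, dotp (S (v i)) (v j) = dotp (v i) (T (v j))) -> is_adjoint S T.
Proof.
move=> ST u w; rewrite dotpC [RHS]dotpC; congr (_^*); apply/esym.
move: w; apply: total_dotp_eq => i; rewrite dotpC [RHS]dotpC; congr (_^*).
by apply/esym/total_dotp_eq.
Qed.

Lemma total_eq0 (w : H) : (forall i, dotp (v i) w = 0) -> w = 0.
Proof.
move=> vw; apply/eqP; rewrite -(dnorm_eq0 (@dotp R H)); apply/eqP.
apply: (@total_linear_eq0 (R[i]^o) (fun u => dotp u w) `|w|) => // [c x y|u].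
  by rewrite linearPl.
by rewrite mulrC hilbert_cauchy_schwarz.
Qed.

End TotalFamily.

Context (v w : I -> H) (tot_v : total v).
Context (vw : forall i j, dotp (w i) (w j) = dotp (v i) (v j)).

(** Equality of the Gram matrices gives equality of norms, so a linear relation
among the v i also holds among the w i. *)
Lemma lin_comb_isometry x y :
  `|lin_comb w x - lin_comb w y| = `|lin_comb v x - lin_comb v y|.
Proof.
have cat f : lin_comb f x - lin_comb f y =
    lin_comb f (x ++ [seq (-1 * p.1, p.2) | p <- y]).
  by rewrite lin_combD lin_combZ scaleN1r.
rewrite !cat; set z := (x ++ _); rewrite !hilbert_normE; congr sqrtC.
have dot f : dotp (lin_comb f z) (lin_comb f z) =
    \sum_(p <- z) \sum_(r <- z) p.1 * (r.1^* * dotp (f p.2) (f r.2)).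
  rewrite linear_sumlz; apply: eq_bigr => p _.
  rewrite linear_sumr; apply: eq_bigr => r _.
  by rewrite linearZl_LR linearZr_LR.
by rewrite !dot; apply: eq_bigr => p _; apply: eq_bigr => r _; rewrite vw.
Qed.

(** The image y of u under the extension is obtained as the limit, by
completeness, of the combinations of the w i along the combinations of the v i
that approach u. The inequality for all x determines y and makes linearity and
boundedness immediate. *)
Lemma isometry_limit u : exists y : H,
  forall x, `|y - lin_comb w x| <= `|u - lin_comb v x|.
Proof.
pose B (e : R[i]) := [set x | `|u - lin_comb v x| < e].
pose F := filter_from [set e : R[i] | 0 < e] B.
have FF : ProperFilter F.
  apply: filter_from_proper => [|e e0]; last exact: tot_v.
  apply: filter_from_filter => [|e1 e2 e10 e20]; first by exists 1 => /=.
  have [e12|e21] := real_leP (gtr0_real e10) (gtr0_real e20).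
    by exists e1 => // x xe; split => //; exact: lt_le_trans e12.
  by exists e2 => // x xe; split => //; exact: lt_trans e21.
have BB e x y : B e x -> B e y -> `|lin_comb w x - lin_comb w y| <= e + e.
  move=> Bx By; rewrite lin_comb_isometry (le_trans (ler_distD u _ _))//.
  by rewrite lerD// ltW// distrC.
have /cauchy_cvg : cauchy (lin_comb w x @[x --> F]).
  apply/cauchyP => e e0; have e4 : 0 < e / 4 by rewrite divr_gt0.
  have [x Bx] := tot_v u e4; exists (lin_comb w x), (e / 4) => // y By.
  rewrite -ball_normE /= (le_lt_trans (BB _ _ _ Bx By))//.
  by rewrite -mulrDl ltr_pdivrMr// -mulr2n mulr_natr ltr_pMn2l.
move=> /cvg_ex[y /cvgrPdist_lt Fy]; exists y => x.
apply/ler_addgt0Pr => e e0; have e2 : 0 < e / 2 by rewrite divr_gt0.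
have [z [yz uz]] : (([set z | `|y - lin_comb w z| < e / 2] `&` B (e / 2)) !=set0).
  by apply: (@filter_ex _ F); apply: filterI; [exact: (Fy _ e2)|exists (e / 2)].
rewrite (le_trans (ler_distD (lin_comb w z) _ _))//.
rewrite [X in _ <= _ + X]splitr addrCA lerD ?(ltW yz)//.
rewrite lin_comb_isometry (le_trans (ler_distD u _ _))//.
by rewrite [X in X <= _]addrC lerD2l distrC ltW.
Qed.

Theorem isometry_extension : exists F : bounded_op H, forall i, F (v i) = w i.
Proof.
have [F FP] := choice isometry_limit.
have linF : linear F.
  move=> c u u'; apply/eqP; rewrite -subr_eq0; apply/eqP.
  apply: (@norm_small_eq0 _ _ ((`|c| + 1) *+ 2)) => [|e e0].
    by rewrite mulrn_wge0// addr_ge0.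
  have [x ux] := tot_v u e0; have [x' ux'] := tot_v u' e0.
  pose z := [seq (c * p.1, p.2) | p <- x] ++ x'.
  have zE f : lin_comb f z = c *: lin_comb f x + lin_comb f x'.
    by rewrite lin_combD lin_combZ.
  have le f a a' : `|a - lin_comb f x| <= e -> `|a' - lin_comb f x'| <= e ->
      `|c *: a + a' - lin_comb f z| <= (`|c| + 1) * e.
    move=> ax ax'; rewrite zE opprD addrACA -scalerBr.
    by rewrite (le_trans (ler_normD _ _))// normrZ mulrDl mul1r lerD// ler_wpM2l.
  rewrite (le_trans (ler_distD (lin_comb w z) _ _))//.
  rewrite mulr2n mulrDl lerD//.
    by rewrite (le_trans (FP _ _))// le// ltW.
  by rewrite distrC le// (le_trans (FP _ _))// ltW.
pose FL : {linear H -> H} := HB.pack F (GRing.isLinear.Build _ _ _ _ F linF).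
have bF : exists M : R, forall u, `|FL u| <= M%:C * `|u|.
  exists 1 => u; have := FP u [::].
  by rewrite /lin_comb !big_nil !subr0 mul1r.
exists (BoundedOp bF) => i /=; apply/eqP; rewrite -subr_eq0 -normr_le0.
by have := FP (v i) [:: (1, i)]; rewrite !lin_comb1 subrr normr0.
Qed.

End IsometryExtension.

(** * The q-inner product *)

Lemma inversionsE n (p : 'S_n) :
  inversions p = (\sum_(i < n) \sum_(j < n) ((i < j) && (p j < p i)))%N.
Proof.
rewrite /inversions -sum1_card pair_big/= big_mkcond/=.
by apply: eq_bigr => -[i j] _ /=; rewrite unfold_in/=; case: (_ && _).
Qed.

Definition rev_perm n : 'S_n := perm (@rev_ord_inj n).

(** Conjugation by the order-reversing permutation carries the inversion (i, j)
to the inversion (rev j, rev i). *)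
Lemma inversions_rev n (p : 'S_n) :
  inversions (rev_perm n * p * rev_perm n)%g = inversions p.
Proof.
rewrite !inversionsE exchange_big/= (reindex_inj rev_ord_inj)/=.
apply: eq_bigr => i _; rewrite (reindex_inj rev_ord_inj)/=.
apply: eq_bigr => j _; rewrite !permM !permE !rev_ordK/=.
congr (nat_of_bool (_ && _)).
  by have := ltn_ord i; have := ltn_ord j; lia.
by have := ltn_ord (p i); have := ltn_ord (p j); lia.
Qed.

Lemma lift_lt n (h : 'I_n.+1) (i j : 'I_n) : (lift h i < lift h j)%N = (i < j)%N.
Proof. by rewrite /= /bump; case: leqP; case: leqP; lia. Qed.

(** [lift_perm k ord0 p] sends k to the least value, so the inversions that
involve k are the k pairs (i, k) with i < k; the others are those of p. *)
Lemma inversions_lift n (k : 'I_n.+1) (p : 'S_n) :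
  inversions (lift_perm k ord0 p) = (k + inversions p)%N.
Proof.
rewrite !inversionsE (bigD1_ord k)//= big1 ?add0n; last first.
  by move=> j _; rewrite lift_perm_id ltn0 andbF.
under eq_bigr => i _.
  rewrite (bigD1_ord k)//= lift_perm_id lift_perm_lift /= andbT.
  under eq_bigr => j _ do rewrite lift_perm_lift.
  under eq_bigr => j _ do rewrite lift_lt (lift_lt ord0).
  over.
rewrite big_split/=; congr addn.
under eq_bigr => i _.
  have -> : (bump k i < k)%N = (i < k)%N by rewrite /bump; lia.
  over.
rewrite -(big_mkcond (fun i : 'I_n => (i < k)%N) (fun=> 1%N))/=.
by rewrite -(big_ord_widen n (fun=> 1%N)) ?sum1_card ?card_ord// -ltnS.
Qed.

(** Injectivity suffices, as (n + 1)! = (n + 1) n!. *)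
Lemma lift_perm0_bij n :
  bijective (fun kp : 'I_n.+1 * 'S_n => lift_perm kp.1 ord0 kp.2).
Proof.
apply: inj_card_bij; last by rewrite card_prod card_ord !card_Sn.
move=> [k p] [k' p'] /= E; have kk' : k = k'.
  apply: (@perm_inj _ (lift_perm k ord0 p)).
  by rewrite lift_perm_id E lift_perm_id.
rewrite -{}kk' in E *; congr pair; apply/permP => i.
by apply: (@lift_inj _ ord0); rewrite -!(@lift_perm_lift _ k) E.
Qed.

Section QInner.
Context (R : realType) (q : R) (H : hilbertType R).
Implicit Types s t : nat -> H.

(** The q-inner product with the length as a separate argument, which avoids
transport between the types of permutations of equal lengths. *)
Definition q_form n s t : R[i] :=
  \sum_(p : 'S_n) (q ^+ inversions p)%:C * \prod_(i < n) dotp (s i) (t (p i)).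

Lemma q_innerE (s t : seq H) : size s = size t ->
  q_inner q s t = q_form (size t) (nth 0 s) (nth 0 t).
Proof. by move=> st; rewrite /q_inner st eqxx. Qed.

Lemma q_inner_size (s t : seq H) : size s != size t -> q_inner q s t = 0.
Proof. by rewrite /q_inner => /negbTE ->. Qed.

Lemma q_inner_rev (s t : seq H) : q_inner q (rev s) (rev t) = q_inner q s t.
Proof.
have [st|st] := eqVneq (size s) (size t); last by rewrite !q_inner_size ?size_rev.
rewrite !q_innerE ?size_rev//; set n := size t.
have inv : involutive (fun p : 'S_n => rev_perm n * p * rev_perm n)%g.
  by move=> p; apply/permP => i; rewrite !permM !permE !rev_ordK.
rewrite /q_form (reindex_inj (inv_inj inv)); apply: eq_bigr => p _.
rewrite inversions_rev; congr (_ * _).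
rewrite (reindex_inj rev_ord_inj); apply: eq_bigr => i _ /=.
rewrite !permM !permE rev_ordK /= !nth_rev ?st -/n; last 2 first.
- by have := ltn_ord i; lia.
- by have := ltn_ord (p i); lia.
congr (dotp (nth 0 s _) (nth 0 t _)); first by have := ltn_ord i; lia.
by have := ltn_ord (p i); lia.
Qed.

(** The permutations are grouped by the position k that is paired with e; this
accounts for the factor q^k. The right-hand side is the inner product of t with
the value of the annihilator of e at s. *)
Lemma q_inner_cons (s t : seq H) (e : H) :
  q_inner q s (e :: t) = \sum_(k < size s) (q ^+ k)%:C * dotp s`_k e *
    q_inner q (take k s ++ drop k.+1 s) t.
Proof.
have sz k : (k < size s)%N -> size (take k s ++ drop k.+1 s) = (size s).-1.
  by move=> ks; rewrite size_cat size_takel ?size_drop; lia.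
have [st|st] := eqVneq (size s) (size t).+1; last first.
  rewrite q_inner_size// big1// => k _; rewrite (@q_inner_size _ t) ?mulr0//.
  by rewrite sz//; apply: contra st; have := ltn_ord k; lia.
rewrite q_innerE//= /q_form st.
rewrite (reindex _ (onW_bij _ (lift_perm0_bij (size t)))).
rewrite -(pair_bigA _ (fun k p => (q ^+ inversions (lift_perm k ord0 p))%:C *
  \prod_(i < (size t).+1) dotp s`_i (e :: t)`_(lift_perm k ord0 p i)))/=.
  apply: eq_bigr => k _.
  have ks : (k < size s)%N by rewrite st.
  rewrite q_innerE ?sz ?st// /q_form mulr_sumr; apply: eq_bigr => p _.
  rewrite (bigD1_ord k)//= lift_perm_id inversions_lift exprD rmorphM/=.
  rewrite -!mulrA; congr (_ * _); rewrite mulrCA; congr (_ * (_ * _)).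
  apply: eq_bigr => i _; rewrite lift_perm_lift/=; congr (dotp _ _).
  rewrite nth_cat size_takel; last by lia.
  rewrite /bump; case: ltnP => ik; first by rewrite add0n nth_take.
  by rewrite nth_drop; congr nth; lia.
Qed.

(** There are n! permutations, each of weight at most 1 in modulus, and the
inner products are bounded by the Cauchy-Schwarz inequality. *)
Lemma q_inner_norm_le (s : seq H) : -1 < q < 1 ->
  `|q_inner q s s| <= (\prod_(i < size s) `|s`_i|) ^+ 2 *+ (size s)`!.
Proof.
move=> /andP[q1 q2]; rewrite q_innerE// /q_form.
rewrite (le_trans (ler_norm_sum _ _ _))// -card_Sn -sumr_const.
apply: ler_sum => p _; rewrite normrM normr_prod expr2.
rewrite [X in _ <= _ * X](reindex_inj (@perm_inj _ p))/= -big_split/=.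
rewrite -[leRHS]mul1r ler_pM ?prodr_ge0//.
  rewrite rmorphXn normrX exprn_ile1//.
  by rewrite normc_def/= expr0n/= addr0 sqrtr_sqr lecR ler_norml !ltW.
by apply: ler_prod => i _; rewrite normr_ge0/= hilbert_cauchy_schwarz.
Qed.
End QInner.

(** * Totality of the canonical basis of l^2(Z) *)

Section L2Total.
Context (R : realType).
Implicit Types f : l2 R.

Definition l2_trunc f n : l2 R :=
  \sum_(k < n) (f (Posz k) *: l2_basis R (Posz k) +
    f (Negz k) *: l2_basis R (Negz k)).

Lemma l2_addE (f g : l2 R) j : (f + g) j = f j + g j. Proof. by []. Qed.

Lemma l2_scaleE (c : R[i]) f j : (c *: f) j = c * f j. Proof. by []. Qed.

Lemma l2_basisE i j : l2_basis R i j = (j == i)%:R. Proof. by []. Qed.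

Lemma l2_truncE f n j : l2_trunc f n j =
  if (match j with Posz m => m | Negz m => m end < n)%N then f j else 0.
Proof.
rewrite /l2_trunc; elim: n => [|n IH]; first by rewrite big_ord0.
rewrite big_ord_recr l2_addE {}IH.
rewrite [X in _ + X]l2_addE !l2_scaleE !l2_basisE.
case: j => m.
  rewrite (_ : (Posz m == Posz (ord_max : 'I_n.+1)) = (m == n))//.
  rewrite (_ : (Posz m == Negz _) = false)// mulr0 addr0 ltnS (leq_eqVlt m n).
  by have [->|] := eqVneq m n; rewrite ?ltnn ?mulr1 ?add0r// mulr0 addr0.
rewrite (_ : (Negz m == Negz (ord_max : 'I_n.+1)) = (m == n))//.
rewrite (_ : (Negz m == Posz _) = false)// mulr0 add0r ltnS (leq_eqVlt m n).
by have [->|] := eqVneq m n; rewrite ?ltnn ?mulr1 ?add0r// mulr0 addr0.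
Qed.

(** The squared norm of the remainder is a tail of the convergent series of the
squared moduli of the coordinates. *)
Lemma l2_trunc_cvg f (e : R) : 0 < e -> exists n, `|f - l2_trunc f n| <= e%:C.
Proof.
move=> e0; pose g k := sqmod (f k).
have /cvgrPdist_lt/(_ (e ^+ 2)) := @l2_cvg R f.
rewrite exprn_gt0// => /(_ isT) [n _ /(_ n (leqnn n))] /= gn.
exists n; apply: l2_norm_le; first exact: ltW.
have g0 k : 0 <= sqmod ((f - l2_trunc f n) k) by exact: sqmod_ge0.
apply: zsum_le => // [|m]; first exact: l2_cvg.
pose N := maxn m n.
apply: (@le_trans _ _ (zpsum (fun k => sqmod ((f - l2_trunc f n) k)) N)).
  by apply: zpsum_homo => //; exact: leq_maxl.
have -> : zpsum (fun k => sqmod ((f - l2_trunc f n) k)) N = zpsum g N - zpsum g n.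
  have -> : (fun k => sqmod ((f - l2_trunc f n) k)) = fun k =>
      if (match k with Posz m => m | Negz m => m end < n)%N then 0 else g k.
    apply/funext => k; rewrite -[(f - _) k]/(f k - l2_trunc f n k) l2_truncE.
    by case: ifP; rewrite ?subr0// subrr /sqmod/= expr0n addr0.
  rewrite /zpsum /series/= (big_cat_nat _ (leq_maxr m n))//.
  rewrite [in RHS](big_cat_nat _ (leq_maxr m n))//= addrAC subrr add0r.
  rewrite big_nat_cond big1 ?add0r => [|k]; last first.
    by move=> /andP[/andP[_ ->] _]; rewrite addr0.
  rewrite big_nat_cond [RHS]big_nat_cond.
  by apply: eq_bigr => k /andP[/andP[nk _] _]; rewrite ltnNge nk.
have gN : zpsum g N <= zsum g.
  by apply: zpsum_le_zsum => [k|]; [exact: sqmod_ge0|exact: l2_cvg].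
have := le_lt_trans (ler_norm _) gn; rewrite -/(zsum _) -/g; lra.
Qed.

Lemma l2_basis_total : total (l2_basis R).
Proof.
move=> f e e0; have eE : e = (complex.Re e)%:C by apply/esym/RRe_real/gtr0_real.
have {}e0 : 0 < complex.Re e by rewrite -ltcR -eE.
have [|n fn] := @l2_trunc_cvg f (complex.Re e / 2); first by rewrite divr_gt0.
exists (flatten [seq [:: (f (Posz k), Posz k); (f (Negz k), Negz k)] |
  k <- index_iota 0 n]).
rewrite /lin_comb big_flatten big_map big_mkord.
under eq_bigr do rewrite big_cons big_seq1.
by rewrite (le_lt_trans fn)// [ltRHS]eE ltcR ltr_pdivrMr//; lra.
Qed.

End L2Total.

(** * Right creation operators on the q-Fock space *)

Section RightCreation.
Context (R : realType) (q : R) (hq : -1 < q < 1) (G : q_fock q (l2 R)).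
Local Notation tensor := (fock_tensor G).
Local Notation e_ := (l2_basis R).
Local Notation q_annihilator := (@is_annihilator R q (l2 R) G).

Lemma l2_basis_orthogonal i j : i != j -> dotp (e_ i) (e_ j) = 0.
Proof.
move=> ij; rewrite -[LHS]/(zcsum (fun k => e_ i k * (e_ j k)^*)).
rewrite (_ : (fun k => _) = fun=> 0); last first.
  apply/funext => k; rewrite !l2_basisE.
  by have [->|] := eqVneq k i; rewrite ?(negbTE ij) ?conjC0 ?mulr0// mul0r.
have := zcsumZ 0 (l2_dot_cvg (0 : l2 R) 0).
by rewrite mul0r; under eq_fun do rewrite mul0r.
Qed.

Lemma fock_tensor_total : total tensor.
Proof.
move=> u e e0; have : closure [set u : G | exists n c s,
  u = \sum_(i < n) c i *: tensor (s i)] u by rewrite fock_dense.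
move=> /(_ _ (nbhsx_ballx u e e0))[_ [[n [c [s ->]]]]].
rewrite -ball_normE/= => us; exists [seq (c i, s i) | i <- enum 'I_n].
by rewrite /lin_comb big_map big_enum.
Qed.

Lemma flip_op_exists :
  exists F : bounded_op G, forall s, F (tensor s) = tensor (rev s).
Proof.
apply: (isometry_extension fock_tensor_total) => s t.
by rewrite !fock_dot q_inner_rev.
Qed.

(** The flip is an isometric involution on the elementary tensors. *)
Lemma flip_op_self_adjoint (F : bounded_op G) :
  (forall s, F (tensor s) = tensor (rev s)) -> is_adjoint F F.
Proof.
move=> Fs; apply: (total_adjoint fock_tensor_total) => s t.
by rewrite !Fs !fock_dot -q_inner_rev revK.
Qed.

(** Any adjoint of the annihilator of f is the left creator of f: both have the
same inner products with the elementary tensors. *)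
Lemma annihilator_adjoint (l l' : bounded_op G) f :
  q_annihilator f l -> is_adjoint l l' ->
  forall s, l' (tensor s) = tensor (f :: s).
Proof.
move=> lf ll' s; apply/eqP; rewrite -subr_eq0; apply/eqP.
apply: (total_eq0 fock_tensor_total) => t.
rewrite linearBr/= -ll' lf !fock_dot q_inner_cons linear_sumlz.
apply/eqP; rewrite subr_eq0; apply/eqP/eq_bigr => k _.
by rewrite linearZl_LR/= fock_dot.
Qed.

(** r and r' are the conjugates by the flip of the left annihilator l and of the
left creator l'; their boundedness is inherited from l and l'. *)
Lemma right_creation_exists (l l' : bounded_op G) f :
  q_annihilator f l -> is_adjoint l l' -> exists r r' : bounded_op G,
  [/\ is_adjoint r r', forall s, r' (tensor s) = tensor (rcons s f) &
      r (tensor [::]) = 0].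
Proof.
move=> lf ll'; have [F FE] := flip_op_exists.
have FF := flip_op_self_adjoint FE.
exists (op_comp F (op_comp l F)), (op_comp F (op_comp l' F)); split.
- by move=> u v /=; rewrite FF ll' FF.
- by move=> s /=; rewrite FE (annihilator_adjoint lf ll') FE rev_cons revK.
- by rewrite /= FE lf big_ord0 linear0.
Qed.

(** The annihilator also contracts the factor g appended on the right, but
orthogonality kills this term; the other terms leave g in place. *)
Lemma annihilator_right_comm (l r' : bounded_op G) f g :
  q_annihilator f l -> (forall s, r' (tensor s) = tensor (rcons s g)) ->
  dotp g f = 0 -> forall u, l (r' u) = r' (l u).
Proof.
move=> lf r'g gf.
apply: (@total_op_eq _ _ _ _ fock_tensor_total (op_comp l r') (op_comp r' l)).
move=> s /=; rewrite r'g !lf linear_sum size_rcons big_ord_recr/=.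
rewrite nth_rcons ltnn eqxx gf mulr0 scale0r addr0; apply: eq_bigr => k _.
rewrite linearZ_LR r'g nth_rcons ltn_ord; congr (_ *: tensor _).
by rewrite -!cats1 takel_cat 1?ltnW// cats1 drop_rcons// -cats1 catA.
Qed.

Lemma left_right_creation_comm (l' r' : bounded_op G) f g :
  (forall s, l' (tensor s) = tensor (f :: s)) ->
  (forall s, r' (tensor s) = tensor (rcons s g)) ->
  forall u, l' (r' u) = r' (l' u).
Proof.
move=> l'f r'g.
apply: (@total_op_eq _ _ _ _ fock_tensor_total (op_comp l' r') (op_comp r' l')).
by move=> s /=; rewrite r'g !l'f r'g.
Qed.

Lemma q_inner_rcons_linear s t (c : R[i]) (f g : l2 R) :
  q_inner q t (rcons s (c *: f + g)) =
  c^* * q_inner q t (rcons s f) + q_inner q t (rcons s g).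
Proof.
rewrite -!(q_inner_rev q t) !rev_rcons !q_inner_cons mulr_sumr -big_split/=.
apply: eq_bigr => k _; rewrite linearPr/=; ring.
Qed.

(** Linearity of the tensor in its last factor is read off from the expansion of
the inner product along that factor, moved to the front by the flip. *)
Lemma fock_tensor_rcons_linear s : linear (fun f => tensor (rcons s f)).
Proof.
move=> c f g; apply/eqP; rewrite -subr_eq0; apply/eqP.
apply: (total_eq0 fock_tensor_total) => t.
by rewrite linearBr/= linearPr/= !fock_dot q_inner_rcons_linear subrr.
Qed.

Lemma fock_tensor_rcons_bounded s : exists2 C : R[i], 0 <= C &
  forall f, `|tensor (rcons s f)| <= C * `|f|.
Proof.
pose P := \prod_(i < size s) `|s`_i|; pose N : R[i] := ((size s).+1)`!%:R.
have P0 : 0 <= P by rewrite prodr_ge0.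
have N1 : 1 <= N by rewrite ler1n fact_gt0.
exists (P * N) => [|f]; first by rewrite mulr_ge0// (le_trans _ N1).
rewrite -(@ler_pXn2r _ 2)// ?nnegrE ?mulr_ge0// ?(le_trans _ N1)//.
rewrite dotp_norm fock_dot (le_trans (real_ler_norm _))//.
  by rewrite -(fock_dot G) ger0_real// dnorm_ge0.
rewrite (le_trans (q_inner_norm_le _ hq))// size_rcons big_ord_recr/=.
rewrite nth_rcons ltnn eqxx.
under eq_bigr => i _ do rewrite nth_rcons ltn_ord.
rewrite -/P -mulr_natr -/N [P * N * _]mulrAC [leRHS]exprMn ler_wpM2l//.
  by rewrite exprn_ge0// mulr_ge0.
by rewrite expr2 ler_peMl// (le_trans _ N1).
Qed.

(** The last factor may be tested on basis vectors, since the tensor depends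
linearly and continuously on it. *)
Lemma rcons_basis_ext (V : normedModType R[i]) (D : G -> V) (M : R[i]) s :
  linear D -> 0 <= M -> (forall u, `|D u| <= M * `|u|) ->
  (forall j, D (tensor (rcons s (e_ j))) = 0) ->
  forall f, D (tensor (rcons s f)) = 0.
Proof.
move=> lD M0 DM D0; have [C C0 sC] := fock_tensor_rcons_bounded s.
apply: (total_linear_eq0 (@l2_basis_total R) (M := M * C)) => [c f g||f|//].
- by rewrite fock_tensor_rcons_linear lD.
- exact: mulr_ge0.
- by rewrite (le_trans (DM _))// -mulrA ler_wpM2l.
Qed.

(** Commuting with the r j makes the vacuum an eigenvector of T; commuting with
the r' j propagates the eigenvalue to all tensors, which are built from the
vacuum by appending factors. *)
Lemma right_commutant_scalar (r r' : int -> bounded_op G) (T : bounded_op G) :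
  (forall j, is_adjoint (r j) (r' j)) ->
  (forall j s, r' j (tensor s) = tensor (rcons s (e_ j))) ->
  (forall j, r j (tensor [::]) = 0) ->
  (forall j u, T (r j u) = r j (T u)) -> (forall j u, T (r' j u) = r' j (T u)) ->
  exists c, forall u, T u = c *: u.
Proof.
move=> rr' r'E r0 Tr Tr'; set vac := tensor [::].
have vac1 : dotp vac vac = 1.
  rewrite fock_dot q_innerE// /q_form (big_pred1 1%g) => [|p]; last first.
    by apply/esym/eqP/permP => -[].
  rewrite big_ord0 mulr1 (_ : inversions 1%g = 0%N)//.
  by rewrite inversionsE big_ord0.
pose c := dotp (T vac) vac; exists c.
have Tvac : T vac = c *: vac.
  apply/eqP; rewrite -subr_eq0; apply/eqP.
  apply: (total_eq0 fock_tensor_total) => s.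
  rewrite linearBr/= linearZr_LR/=; case/lastP: s => [|s f].
    by rewrite -/vac vac1 mulr1 /c dotpC subrr.
  rewrite fock_dot q_inner_size ?size_rcons// mulr0 subr0.
  (* T vac is orthogonal to the range of each r' j because r j T vac = 0. *)
  apply: (@rcons_basis_ext (R[i]^o) (fun u => dotp u (T vac)) `|T vac|) => //
    [x u v|u|j].
  - by rewrite linearPl.
  - by rewrite mulrC hilbert_cauchy_schwarz.
  - by rewrite -r'E (adjoint_sym (rr' j)) -Tr r0 linear0 linear0r.
pose D u := T u - c *: u.
have lD : linear D.
  move=> x u v; rewrite /D (linearP T) scalerDr !scalerBr !scalerA mulrC.
  by rewrite opprD addrACA.
have [M M0 TM] := op_bounded_ge0 T.
have DM u : `|D u| <= (M + `|c|) * `|u|.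
  by rewrite (le_trans (ler_normB _ _))// mulrDl lerD// normrZ.
have M1 : 0 <= M + `|c| by rewrite addr_ge0.
have D0 : forall u, D u = 0.
  apply: (total_linear_eq0 fock_tensor_total lD M1 DM).
  elim/last_ind => [|s f IH]; first by rewrite /D Tvac subrr.
  apply: (rcons_basis_ext lD M1 DM) => j.
  move: IH; rewrite /D -r'E Tr' => /eqP; rewrite subr_eq0 => /eqP ->.
  by rewrite linearZ_LR subrr.
by move=> u; apply/eqP; rewrite -subr_eq0; apply/eqP/D0.
Qed.

End RightCreation.

(** * Automatic continuity of *-representations *)

Section CStarRep.
Context (R : realType) (A : cstarAlgType R).
Implicit Types x y h : A.

Lemma cnormZr (c : R) x : 0 <= c -> cnorm (c%:C *: x) = c * cnorm x.
Proof.
move=> c0; have := cnormZ c%:C x; rewrite ger0_norm ?ler0c//.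
by rewrite -rmorphM => /complexI.
Qed.

Lemma cnorm0 : cnorm (0 : A) = 0.
Proof. by have := @cnormZr 0 0 (lexx 0); rewrite mul0r scaler0. Qed.

Lemma cnormN x : cnorm (- x) = cnorm x.
Proof.
have := cnormZ (-1) x; rewrite normrN1 mul1r scaleN1r.
by move=> /complexI.
Qed.

Lemma cnorm_ge0 x : 0 <= cnorm x.
Proof. by have := cnormD x (- x); rewrite subrr cnorm0 cnormN; lra. Qed.

Lemma cnorm_dist x y z : cnorm (x - z) <= cnorm (x - y) + cnorm (y - z).
Proof. by rewrite -(subrKA y) cnormD. Qed.

Lemma cnorm_distC x y : cnorm (x - y) = cnorm (y - x).
Proof. by rewrite -cnormN opprB. Qed.

Lemma cnorm_starE x : cnorm (star x) = cnorm x.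
Proof.
suff le y : cnorm y <= cnorm (star y).
  by apply/le_anti; rewrite le andbT -{2}(starK x) le.
have := cnorm_ge0 (star y); have := cnorm_ge0 y.
rewrite le_eqVlt => /orP[/eqP <-//|y0] _.
by rewrite -(ler_pM2r y0) -expr2 -cnorm_star cnormM.
Qed.

Lemma star1 : star (1 : A) = 1.
Proof. by have := starM (star 1) (1 : A); rewrite mulr1 starK mulr1. Qed.

Lemma starN x : star (- x) = - star x.
Proof. by rewrite -scaleN1r starZ rmorphN1 scaleN1r. Qed.

Lemma starB x y : star (x - y) = star x - star y.
Proof. by rewrite starD starN. Qed.

Lemma cnorm_sqrB x y : cnorm (x * x - y * y) <= (cnorm x + cnorm y) * cnorm (x - y).
Proof.
have -> : x * x - y * y = x * (x - y) + (x - y) * y.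
  by rewrite mulrBr mulrBl subrKA.
rewrite (le_trans (cnormD _ _))// [leRHS]mulrDl lerD ?cnormM//.
by rewrite (le_trans (cnormM _ _))// mulrC.
Qed.

(** Picard iteration for 2 c = h + c^2, that is (1 - c)^2 = 1 - h. *)
Fixpoint sqrt_iter h n : A :=
  if n is m.+1 then (2^-1)%:C *: (h + sqrt_iter h m * sqrt_iter h m) else 0.

(** If the norm of h is at most 1/2, the iterates stay in the ball of radius 1/2,
where c |-> (h + c^2) / 2 contracts distances by a factor 1/2; they are
self-adjoint with h, hence so is their limit z, and b = 1 - z. *)
Lemma cnorm_self_adjoint_sqrt h : star h = h -> cnorm h <= 2^-1 ->
  exists b, star b * b = 1 - h.
Proof.
move=> hh h2; pose c := sqrt_iter h.
have cE n : c n.+1 = (2^-1)%:C *: (h + c n * c n) by [].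
have c2 n : cnorm (c n) <= 2^-1.
  elim: n => [|n IH]; first by rewrite /c/= cnorm0.
  rewrite cE cnormZr//; have := cnormD h (c n * c n); have := cnormM (c n) (c n).
  by have := cnorm_ge0 (c n); nra.
have sc n : star (c n) = c n.
  elim: n => [|n IH]; first by rewrite /c/= -(subrr h) starB !subrr.
  by rewrite cE starZ starD starM IH hh conj_Creal// ger0_real// ler0c invr_ge0.
have cB n m : cnorm (c m.+1 - c n.+1) <= 2^-1 * cnorm (c m - c n).
  rewrite !cE -scalerBr cnormZr// opprD addrACA subrr add0r.
  have := cnorm_sqrB (c m) (c n); have := c2 n; have := c2 m.
  have := cnorm_ge0 (c m - c n); nra.
have cauchy_c n m : cnorm (c (n + m)%N - c n) <= 2^-1 ^+ n.
  elim: n => [|n IH].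
    by rewrite add0n expr0 [c 0%N]/0 subr0 (le_trans (c2 _))// invf_le1 ?ler1n.
  by rewrite addSn (le_trans (cB _ _))// exprS ler_wpM2l.
have small (e : R) : 0 < e -> exists N, forall n, (N <= n)%N -> 2^-1 ^+ n < e.
  have : GRing.exp (2^-1 : R) @ \oo --> (0 : R).
    by apply: cvg_expr; rewrite ger0_norm ?invr_ge0// invf_lt1 ?ltr1n.
  move=> /cvgrPdist_lt c0 /c0[N _ Nn]; exists N => n /Nn /=.
  by rewrite sub0r normrN ger0_norm// exprn_ge0.
have [|z cz] := @cnorm_complete _ A c.
  move=> e e0; have [|N Nn] := small (e / 2); first by rewrite divr_gt0.
  have le k : (N <= k)%N -> cnorm (c k - c N) < e / 2.
    by move=> Nk; rewrite -(subnKC Nk) (le_lt_trans (cauchy_c _ _))// Nn.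
  exists N => m n Nm NN; have := cnorm_dist (c m) (c N) (c n).
  by rewrite [cnorm (c N - _)]cnorm_distC; have := le _ Nm; have := le _ NN; lra.
have sz : star z = z.
  apply/eqP; rewrite -subr_eq0; apply/eqP/cnorm0_eq0/le_anti.
  rewrite cnorm_ge0 andbT; apply/ler_addgt0Pr => e e0.
  have [|N Nn] := cz (e / 2); first by rewrite divr_gt0.
  have := cnorm_dist (star z) (c N) z; rewrite -{1}(sc N) -starB cnorm_starE.
  by rewrite [cnorm (z - _)]cnorm_distC; have := Nn _ (leqnn N); lra.
have fz : z + z = h + z * z.
  apply/eqP; rewrite -subr_eq0; apply/eqP/cnorm0_eq0/le_anti.
  rewrite cnorm_ge0 andbT; apply/ler_addgt0Pr => e e0.
  (* The defect is at most 2 |z - c_(N+1)| + (1/2 + |z|) |c_N - z|, hence at most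
     (3 + |z|) d when both distances are below d. *)
  have M0 : 0 < 3 + cnorm z by have := cnorm_ge0 z; lra.
  pose d := e / (3 + cnorm z); have d0 : 0 < d by rewrite divr_gt0.
  have dE : 3 * d + cnorm z * d = e by rewrite -mulrDl mulrC divfK// gt_eqF.
  have [N Nn] := cz d d0.
  have cc : c N.+1 + c N.+1 = h + c N * c N.
    rewrite cE -scalerDl -rmorphD/= (_ : 2^-1 + 2^-1 = 1 :> R) ?scale1r//.
    by field.
  have -> : z + z - (h + z * z) =
      (z - c N.+1) + (z - c N.+1) + (c N * c N - z * z).
    by rewrite [X in _ = X + _]addrACA -opprD cc !opprD !addrA subrK.
  have := cnormD ((z - c N.+1) + (z - c N.+1)) (c N * c N - z * z).
  have := cnormD (z - c N.+1) (z - c N.+1); rewrite [cnorm (z - _)]cnorm_distC.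
  have := cnorm_sqrB (c N) z.
  have : (cnorm (c N) + cnorm z) * cnorm (c N - z) <= (2^-1 + cnorm z) * d.
    by rewrite ler_pM ?addr_ge0 ?cnorm_ge0 ?lerD2r ?c2// ltW// Nn.
  by have := Nn _ (leqnSn N); rewrite mulrDl; lra.
(* (1 - z)^2 = 1 - (z + z) + z^2 = 1 - h. *)
exists (1 - z); rewrite starB star1 sz mulrBr mulr1 mulrBl mul1r.
have -> : 1 - z - (z - z * z) = 1 - (z + z - z * z).
  by rewrite -[z + z - _]addrA [in RHS]opprD addrA.
by rewrite fz addrK.
Qed.

Context (H : hilbertType R) (pi : A -> bounded_op H) (hpi : unital_star_rep pi).

Lemma rep_norm_sqr x u : `|pi x u| ^+ 2 = dotp (pi (star x * x) u) u.
Proof.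
by rewrite dotp_norm (star_rep_star hpi) -(star_rep_mul hpi)
  (star_rep_star hpi) starM starK.
Qed.

Lemma rep0 u : pi 0 u = 0.
Proof.
have := star_rep_linear hpi 1 0 0 u; rewrite !scale1r addr0.
by move=> /eqP; rewrite addrC -subr_eq subrr => /eqP <-.
Qed.

Lemma repZ c x u : pi (c *: x) u = c *: pi x u.
Proof. by have := star_rep_linear hpi c x 0 u; rewrite rep0 !addr0. Qed.

Lemma repB x y u : pi (x - y) u = pi x u - pi y u.
Proof.
by rewrite -(scaleN1r y) addrC (star_rep_linear hpi) scaleN1r addrC.
Qed.

(** With b* b = 1 - x* x, the number |u|^2 - |pi(x) u|^2 = |pi(b) u|^2 is
nonnegative. The threshold 1/2 is not optimal, but only continuity at 0
matters. *)
Lemma rep_contraction x u : cnorm x <= 2^-1 -> `|pi x u| <= `|u|.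
Proof.
move=> x2; have hh : star (star x * x) = star x * x by rewrite starM starK.
have h2 : cnorm (star x * x) <= 2^-1.
  by rewrite cnorm_star expr2; have := cnorm_ge0 x; nra.
have [b b2] := cnorm_self_adjoint_sqrt hh h2.
rewrite -(@ler_pXn2r _ 2)// ?nnegrE// -subr_ge0.
suff <- : `|pi b u| ^+ 2 = `|u| ^+ 2 - `|pi x u| ^+ 2 by rewrite exprn_ge0.
rewrite !rep_norm_sqr b2 dotp_norm -linearBl/=; congr (dotp _ _).
by rewrite repB (star_rep_one hpi).
Qed.

Lemma rep_continuous (e : R) x u : 0 < e -> cnorm x < e / 2 ->
  `|pi x u| <= e%:C * `|u|.
Proof.
move=> e0 xe; have -> : x = e%:C *: ((e^-1)%:C *: x).
  by rewrite scalerA -rmorphM/= divff ?scale1r// gt_eqF.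
have e0' := ltW e0; rewrite repZ normrZ ger0_norm ?ler0c// ler_wpM2l ?ler0c//.
apply: rep_contraction; rewrite cnormZr ?invr_ge0//.
by rewrite mulrC ler_pdivrMr// mulrC ltW.
Qed.

Lemma rep_comm_star x (r r' : bounded_op H) : is_adjoint r r' ->
  (forall u, pi x (r' u) = r' (pi x u)) ->
  forall u, pi (star x) (r u) = r (pi (star x) u).
Proof.
move=> rr' xr' u; apply: dotp_inj => v.
by rewrite (star_rep_star hpi) starK rr' -xr' rr' (star_rep_star hpi) starK.
Qed.

(** If pi(y) commutes with r, then [pi(x), r] = [pi(x - y), r], which is small
when x - y is. *)
Lemma rep_comm_closed x (r : bounded_op H) :
  (forall e : R, 0 < e -> exists2 y, (forall u, pi y (r u) = r (pi y u)) &
    cnorm (x - y) < e) ->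
  forall u, pi x (r u) = r (pi x u).
Proof.
move=> xr u; apply/eqP; rewrite -subr_eq0; apply/eqP.
have [M M0 rM] := op_bounded_ge0 r.
apply: (@norm_small_eq0 _ _ (`|r u| + M * `|u|)) => [|e e0].
  by rewrite addr_ge0// mulr_ge0.
have eE : e = (complex.Re e)%:C by apply/esym/RRe_real/gtr0_real.
have {}e0 : 0 < complex.Re e by rewrite -ltcR -eE.
have [|y yr xy] := xr (complex.Re e / 2); first by rewrite divr_gt0.
have -> : pi x (r u) - r (pi x u) = pi (x - y) (r u) - r (pi (x - y) u).
  by rewrite !repB linearB/= yr opprB addrA subrK.
rewrite (le_trans (ler_normB _ _))// mulrDl lerD//.
  by rewrite mulrC [X in X * _]eE rep_continuous.
rewrite (le_trans (rM _))// -mulrA ler_wpM2l// mulrC [X in X * _]eE.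
exact: rep_continuous.
Qed.

(** Commutation with both r and its adjoint r' is what makes the set of elements
closed under the involution. *)
Lemma rep_comm_generated (a : A) (r r' : bounded_op H) :
  cstar_generated a -> is_adjoint r r' ->
  (forall u, pi a (r u) = r (pi a u)) ->
  (forall u, pi a (r' u) = r' (pi a u)) ->
  forall x u, pi x (r u) = r (pi x u).
Proof.
move=> ga rr' ar ar'.
pose S : {pred A} := [pred x | `[< (forall u, pi x (r u) = r (pi x u)) /\
  (forall u, pi x (r' u) = r' (pi x u)) >]].
suff xS : forall x, x \in S by move=> x; have /asboolP[] := xS x.
apply: ga.
- split.
  + by apply/asboolP; split => u; rewrite !(star_rep_one hpi).
  + move=> c x y /asboolP[x1 x2] /asboolP[y1 y2]; apply/asboolP.
    by split => u; rewrite !(star_rep_linear hpi) linearP ?x1 ?y1 ?x2 ?y2.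
  + move=> x y /asboolP[x1 x2] /asboolP[y1 y2]; apply/asboolP.
    by split => u; rewrite !(star_rep_mul hpi) ?y1 ?y2 ?x1 ?x2.
- move=> x /asboolP[x1 x2]; apply/asboolP; split.
    exact: rep_comm_star rr' x2.
  exact: rep_comm_star (adjoint_sym rr') x1.
- move=> x Sx; apply/asboolP; split; apply: rep_comm_closed => e /Sx[y].
    by move=> /asboolP[y1 _] xy; exists y.
  by move=> /asboolP[_ y2] xy; exists y.
- by apply/asboolP.
Qed.

End CStarRep.

(** * Commutants and the tail algebra *)

Section Commutants.
Context (R : realType) (H : hilbertType R).
Implicit Types (X Y : set (bounded_op H)) (r S T : bounded_op H).

Lemma commutant_anti X Y : X `<=` Y -> commutant Y `<=` commutant X.
Proof. by move=> XY T TY S /XY; exact: TY. Qed.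

Lemma sub_bicommutant X : X `<=` bicommutant X.
Proof. by move=> T XT S /(_ T XT) ST u; rewrite ST. Qed.

(** The bicommutant condition holds for any commutant; stability under adjoints
comes from the pair r, r' being exchanged by the adjunction. *)
Lemma commutant_von_neumann r r' : is_adjoint r r' ->
  is_von_neumann (commutant [set r; r']).
Proof.
move=> rr'; split; last first.
  apply/seteqP; split; last exact: sub_bicommutant.
  exact: commutant_anti (@sub_bicommutant _).
have comm_adj S T s s' : is_adjoint S T -> is_adjoint s s' ->
    (forall u, S (s' u) = s' (S u)) -> forall u, T (s u) = s (T u).
  move=> ST ss' Ss' u; apply: dotp_inj => v.
  by rewrite (adjoint_sym ST) ss' -Ss' ss' (adjoint_sym ST).
move=> S T rS ST s [->|->] u.
  by apply: (comm_adj _ _ _ _ ST rr') => w; apply: rS; right.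
by apply: (comm_adj _ _ _ _ ST (adjoint_sym rr')) => w; apply: rS; left.
Qed.

(** Take I = {j}: for K disjoint from {j}, the commutant of r and r' is a
von Neumann algebra containing the ranges of the iota_k with k in K. *)
Lemma tail_comm (A : cstarAlgType R) (iota : int -> A -> bounded_op H) j r r' T :
  is_adjoint r r' ->
  (forall k x u, k != j -> iota k x (r u) = r (iota k x u)) ->
  (forall k x u, k != j -> iota k x (r' u) = r' (iota k x u)) ->
  tail_algebra iota T -> forall u, T (r u) = r (T u).
Proof.
move=> rr' ir ir' /(_ [set j] (finite_set1 j)) Tj u; apply: Tj => S [K [_ Kj] KS] v.
apply/esym; apply: (KS (commutant [set r; r'])); last by left.
split; first exact: commutant_von_neumann.
move=> _ [k Kk [x _ <-]] s sr w.
have kj : k != j.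
  by apply/eqP => kj; have : (K `&` [set j]) k by []; rewrite Kj.
by case: sr => ->; [exact: ir|exact: ir'].
Qed.

End Commutants.

(** * Triviality of the tail algebra *)

Theorem proposition4p1 (R : realType) (q : R) (hq : -1 < q < 1)
    (Gamma : q_fock q (l2 R))
    (l : int -> bounded_op Gamma)
    (hl : forall j : int, is_annihilator (l2_basis R j) (l j))
    (A : cstarAlgType R) (a : A) (hA : universal_q_algebra q a)
    (iota : int -> A -> bounded_op Gamma)
    (hiota : forall j : int, unital_star_rep (iota j))
    (hiota_a : forall (j : int) (u : Gamma), iota j a u = l j u) :
  tail_algebra iota = scalar_ops (H := Gamma).
Proof.
have [_ agen _] := hA.
have annih j : is_annihilator (l2_basis R j) (iota j a).
  by move=> s; rewrite hiota_a hl.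
have [r /choice[r' rP]] := choice (fun j =>
  right_creation_exists (annih j) (star_rep_star (hiota j) a)).
have rr' j : is_adjoint (r j) (r' j) by have [] := rP j.
have r'E j s : r' j (fock_tensor Gamma s) =
  fock_tensor Gamma (rcons s (l2_basis R j)) by have [_ ->] := rP j.
have comm_a k j u : k != j -> iota k a (r' j u) = r' j (iota k a u).
  move=> kj; apply: (annihilator_right_comm (annih k) (r'E j)).
  by rewrite l2_basis_orthogonal// eq_sym.
have comm_star k j u : iota k (star a) (r' j u) = r' j (iota k (star a) u).
  apply: (left_right_creation_comm _ (r'E j)).
  exact: annihilator_adjoint (annih k) (star_rep_star (hiota k) a).
(* The adjoint of [comm_star]: left and right annihilators commute. *)
have comm_r k j u : iota k a (r j u) = r j (iota k a u).
  rewrite -[a]starK.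
  by apply: (rep_comm_star (hiota k) (rr' j)) => v; exact: comm_star.
have ir j k x u : k != j -> iota k x (r j u) = r j (iota k x u).
  by move=> kj; apply: (rep_comm_generated (hiota k) agen (rr' j)) => v;
    [exact: comm_r|exact: comm_a].
have ir' j k x u : k != j -> iota k x (r' j u) = r' j (iota k x u).
  move=> kj.
  by apply: (rep_comm_generated (hiota k) agen (adjoint_sym (rr' j))) => v;
    [exact: comm_a|exact: comm_r].
apply/seteqP; split => T.
  move=> tT; apply: (right_commutant_scalar hq rr' r'E).
  - by move=> j; have [] := rP j.
  - by move=> j; apply: tail_comm (rr' j) (ir j) (ir' j) tT.
  - by move=> j; apply: tail_comm (adjoint_sym (rr' j)) (ir' j) (ir j) tT.
move=> [c Tc] I _ S _ u.
by rewrite !Tc linearZ_LR.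
Qed.
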